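(* Let $\mathcal{K}$ be an essentially small rigid tensor triangulated category with duality functor $D$. Then for every object $X$ in $\mathcal{K}$ there is a canonical ring isomorphism $R_X\simeq R_{DX}$ (induced by the functor $D$ on endomorphisms) under which the map $\rho_X$ coincides with $\rho_{DX}$.
   Context: A tensor triangulated category is a triangulated category $(\mathcal{K},\Sigma)$ with a symmetric monoidal structure $(\otimes,\mathbb{1})$ such that $a\otimes -$ and $-\otimes a$ are exact for every $a$ (with suspension isomorphisms $\Sigma a\otimes b\simeq\Sigma(a\otimes b)\simeq a\otimes\Sigma b$ compatible with the symmetric monoidal structure, and the two isomorphisms $\Sigma a\otimes\Sigma b\simeq\Sigma^2(a\otimes b)$ differing by $-1$). Associators are suppressed. It is rigid if every object is (strongly) dualizable and the duality functor $D:\mathcal{K}^{\mathrm{op}}\to\mathcal{K}$ is exact. In a rigid category $\operatorname{supp}(DX)=\operatorname{supp}(X)$. $\operatorname{Spc}(\mathcal{K})$ is the set of prime $\otimes$-ideals (proper thick $\otimes$-ideals $\mathcal{P}$ with $a\otimes b\in\mathcal{P}\Rightarrow a\in\mathcal{P}$ or $b\in\mathcal{P}$), with topology having the sets $\operatorname{supp}(a):=\{\mathcal{P}\mid a\notin\mathcal{P}\}$ as a basis of closed sets. For an object $Z$, $E_Z:=\{f\in[Z,Z]\mid f\otimes Z=Z\otimes f\}$, a subring of $[Z,Z]$. For an object $W$, $R_W$ is the set of pairs $(W^{\otimes n},f)$ with $n\ge1$, $f\in E_{W^{\otimes n}}$, modulo the smallest equivalence relation with $f\sim W^{\otimes m}\otimes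 f$ and $f\sim f\otimes W^{\otimes m}$ for $m\ge1$; equivalently $R_W=\operatorname{colim}_{n\ge1}E_{W^{\otimes n}}$ along the maps $W\otimes-$. The class of $f$ is $[f]$. $R_W$ is a commutative ring with $[f_Z]+[g_{Z'}]=[f_Z\otimes Z'+Z\otimes g_{Z'}]$ and $[f_Z][g_{Z'}]=[(f_Z\otimes Z')\circ(Z\otimes g_{Z'})]$ (subscripts indicate the object of which a morphism is an endomorphism). $\rho_W:\operatorname{supp}(W)\to\operatorname{Spec}(R_W)$ is the spectral map $\mathcal{P}\mapsto\{[f]\mid\operatorname{cone}(f)\notin\mathcal{P}\}$. The canonical isomorphism sends $[f]$, $f\in E_{X^{\otimes n}}$, to $[Df]$, where $Df$ is regarded as an endomorphism of $(DX)^{\otimes n}\simeq D(X^{\otimes n})$. *)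

(* Defs.v *)
From HB Require Import structures.
From mathcomp Require Import all_boot all_algebra.
From mathcomp Require Import boolp.
From Stdlib Require Import Relation_Operators.
Set Implicit Arguments.
Unset Strict Implicit.
Unset Printing Implicit Defensive.
Import GRing.Theory.
Local Open Scope ring_scope.
Local Open Scope quotient_scope.

Declare Scope tt_scope.
Delimit Scope tt_scope with tt.
Local Open Scope tt_scope.

Reserved Notation "g ∘ f" (at level 38, right associativity).
Reserved Notation "A ⊗ B" (at level 35, right associativity).
Reserved Notation "f ⊠ g" (at level 35, right associativity).

Record preadditive_category := PreadditiveCategory {
  ob :> Type;
  hom : ob -> ob -> zmodType;
  idm : forall A, hom A A;
  comp : forall A B C, hom B C -> hom A B -> hom A C;
  compA : forall A B C E (h : hom C E) (g : hom B C) (f : hom A B),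
    comp h (comp g f) = comp (comp h g) f;
  comp1m : forall A B (f : hom A B), comp (idm B) f = f;
  compm1 : forall A B (f : hom A B), comp f (idm A) = f;
  compDl : forall A B C (g g' : hom B C) (f : hom A B),
    comp (g + g') f = comp g f + comp g' f;
  compDr : forall A B C (g : hom B C) (f f' : hom A B),
    comp g (f + f') = comp g f + comp g f'
}.

Arguments hom {_}.
Arguments idm {_}.
Arguments comp {_ A B C}.
Notation "g ∘ f" := (comp g f) : tt_scope.

Section Preadditive.
Variable K : preadditive_category.

Definition inverse_of (A B : K) (f : hom A B) (g : hom B A) : Prop :=
  g ∘ f = idm A /\ f ∘ g = idm B.

Definition is_iso (A B : K) (f : hom A B) : Prop := exists g, inverse_of f g.

Definition isomorphic (A B : K) : Prop := exists f : hom A B, is_iso f.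

Definition is_zero (Z : K) : Prop := idm Z = 0.

Definition is_biproduct (S A B : K) : Prop :=
  exists (i : hom A S) (j : hom B S) (p : hom S A) (q : hom S B),
    [/\ p ∘ i = idm A, q ∘ j = idm B, p ∘ j = 0, q ∘ i = 0
      & i ∘ p + j ∘ q = idm S].

End Preadditive.

Record triangulated_category := TriangulatedCategory {
  tr_cat :> preadditive_category;
  zero_exists : exists Z : tr_cat, is_zero Z;
  biproduct_exists : forall A B : tr_cat, exists S, is_biproduct S A B;

  susp : tr_cat -> tr_cat;
  suspm : forall A B : tr_cat, hom A B -> hom (susp A) (susp B);
  suspm1 : forall A : tr_cat, suspm (idm A) = idm (susp A);
  suspmM : forall (A B C : tr_cat) (g : hom B C) (f : hom A B),
    suspm (g ∘ f) = suspm g ∘ suspm f;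
  suspmD : forall (A B : tr_cat) (f f' : hom A B),
    suspm (f + f') = suspm f + suspm f';
  suspm_bij : forall A B : tr_cat, bijective (@suspm A B);
  susp_esurj : forall B : tr_cat, exists A, isomorphic (susp A) B;

  exact_tri : forall A B C : tr_cat,
    hom A B -> hom B C -> hom C (susp A) -> Prop;
  exact_iso : forall (A B C A' B' C' : tr_cat)
      (f : hom A B) (g : hom B C) (h : hom C (susp A))
      (f' : hom A' B') (g' : hom B' C') (h' : hom C' (susp A'))
      (a : hom A A') (b : hom B B') (c : hom C C'),
    is_iso a -> is_iso b -> is_iso c ->
    b ∘ f = f' ∘ a -> c ∘ g = g' ∘ b -> suspm a ∘ h = h' ∘ c ->
    exact_tri f g h -> exact_tri f' g' h';
  exact_id : forall A Z : tr_cat, is_zero Z ->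
    exact_tri (idm A) (0 : hom A Z) (0 : hom Z (susp A));
  exact_cone : forall (A B : tr_cat) (f : hom A B),
    exists (C : tr_cat) (g : hom B C) (h : hom C (susp A)), exact_tri f g h;
  exact_rot : forall (A B C : tr_cat)
      (f : hom A B) (g : hom B C) (h : hom C (susp A)),
    exact_tri f g h <-> exact_tri g h (- suspm f);
  exact_fill : forall (A B C A' B' C' : tr_cat)
      (f : hom A B) (g : hom B C) (h : hom C (susp A))
      (f' : hom A' B') (g' : hom B' C') (h' : hom C' (susp A'))
      (a : hom A A') (b : hom B B'),
    exact_tri f g h -> exact_tri f' g' h' -> b ∘ f = f' ∘ a ->
    exists c : hom C C', c ∘ g = g' ∘ b /\ suspm a ∘ h = h' ∘ c;
  exact_octa : forall (X Y Z A B C : tr_cat) (f : hom X Y) (g : hom Y Z)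
      (u : hom Y A) (u' : hom A (susp X))
      (v : hom Z B) (v' : hom B (susp Y))
      (w : hom Z C) (w' : hom C (susp X)),
    exact_tri f u u' -> exact_tri g v v' -> exact_tri (g ∘ f) w w' ->
    exists (a : hom A C) (b : hom C B),
      [/\ exact_tri a b (suspm u ∘ v'), a ∘ u = w ∘ g, w' ∘ a = u',
          b ∘ w = v & v' ∘ b = suspm f ∘ w']
}.

Arguments susp {_}.
Arguments suspm {_ A B}.
Arguments exact_tri {_ A B C}.

Definition is_cone (K : triangulated_category) (A B : K) (f : hom A B) (C : K)
    : Prop :=
  exists (g : hom B C) (h : hom C (susp A)), exact_tri f g h.

(* The index type lives in the universe of the morphism sets, which need not
   contain the type of objects. *)
Definition essentially_small (K : preadditive_category) : Prop :=
  exists (I : Type@{Algebra.Zmodule.axioms_.u0}) (F : I -> K),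
    forall A : K, exists i, isomorphic A (F i).

Record tt_category := TTCategory {
  tt_tr :> triangulated_category;

  tens : tt_tr -> tt_tr -> tt_tr;
  tensm : forall A B A' B' : tt_tr,
    hom A A' -> hom B B' -> hom (tens A B) (tens A' B');
  tensm1 : forall A B : tt_tr, tensm (idm A) (idm B) = idm (tens A B);
  tensmM : forall (A B A' B' A'' B'' : tt_tr)
      (f' : hom A' A'') (g' : hom B' B'') (f : hom A A') (g : hom B B'),
    tensm (f' ∘ f) (g' ∘ g) = tensm f' g' ∘ tensm f g;
  tensmDl : forall (A B A' B' : tt_tr) (f f' : hom A A') (g : hom B B'),
    tensm (f + f') g = tensm f g + tensm f' g;
  tensmDr : forall (A B A' B' : tt_tr) (f : hom A A') (g g' : hom B B'),
    tensm f (g + g') = tensm f g + tensm f g';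

  unit_ob : tt_tr;
  assoc : forall A B C : tt_tr,
    hom (tens (tens A B) C) (tens A (tens B C));
  assocV : forall A B C : tt_tr,
    hom (tens A (tens B C)) (tens (tens A B) C);
  lunit : forall A : tt_tr, hom (tens unit_ob A) A;
  lunitV : forall A : tt_tr, hom A (tens unit_ob A);
  runit : forall A : tt_tr, hom (tens A unit_ob) A;
  runitV : forall A : tt_tr, hom A (tens A unit_ob);
  braid : forall A B : tt_tr, hom (tens A B) (tens B A);

  assoc_inv : forall A B C : tt_tr, inverse_of (assoc A B C) (assocV A B C);
  lunit_inv : forall A : tt_tr, inverse_of (lunit A) (lunitV A);
  runit_inv : forall A : tt_tr, inverse_of (runit A) (runitV A);
  braid_inv : forall A B : tt_tr, inverse_of (braid A B) (braid B A);

  assoc_nat : forall (A B C A' B' C' : tt_tr)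
      (f : hom A A') (g : hom B B') (h : hom C C'),
    assoc A' B' C' ∘ tensm (tensm f g) h
      = tensm f (tensm g h) ∘ assoc A B C;
  lunit_nat : forall (A A' : tt_tr) (f : hom A A'),
    lunit A' ∘ tensm (idm unit_ob) f = f ∘ lunit A;
  runit_nat : forall (A A' : tt_tr) (f : hom A A'),
    runit A' ∘ tensm f (idm unit_ob) = f ∘ runit A;
  braid_nat : forall (A B A' B' : tt_tr) (f : hom A A') (g : hom B B'),
    braid A' B' ∘ tensm f g = tensm g f ∘ braid A B;

  pentagon : forall A B C E : tt_tr,
    assoc A B (tens C E) ∘ assoc (tens A B) C E
      = tensm (idm A) (assoc B C E) ∘ assoc A (tens B C) E
          ∘ tensm (assoc A B C) (idm E);
  triangle : forall A B : tt_tr,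
    tensm (idm A) (lunit B) ∘ assoc A unit_ob B = tensm (runit A) (idm B);
  hexagon : forall A B C : tt_tr,
    assoc B C A ∘ braid A (tens B C) ∘ assoc A B C
      = tensm (idm B) (braid A C) ∘ assoc B A C
          ∘ tensm (braid A B) (idm C);

  suspl : forall A B : tt_tr, hom (tens (susp A) B) (susp (tens A B));
  suspr : forall A B : tt_tr, hom (tens A (susp B)) (susp (tens A B));
  suspl_iso : forall A B : tt_tr, is_iso (suspl A B);
  suspr_iso : forall A B : tt_tr, is_iso (suspr A B);
  suspl_nat : forall (A B A' B' : tt_tr) (f : hom A A') (g : hom B B'),
    suspl A' B' ∘ tensm (suspm f) g = suspm (tensm f g) ∘ suspl A B;
  suspr_nat : forall (A B A' B' : tt_tr) (f : hom A A') (g : hom B B'),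
    suspr A' B' ∘ tensm f (suspm g) = suspm (tensm f g) ∘ suspr A B;

  (* Compatibility of the suspension with the symmetric monoidal structure.
     The remaining unit and associativity diagrams follow by symmetry. *)
  suspl_unit : forall A : tt_tr,
    suspm (runit A) ∘ suspl A unit_ob = runit (susp A);
  suspl_assoc : forall A B C : tt_tr,
    suspl A (tens B C) ∘ assoc (susp A) B C
      = suspm (assoc A B C) ∘ suspl (tens A B) C ∘ tensm (suspl A B) (idm C);
  suspl_braid : forall A B : tt_tr,
    suspr B A ∘ braid (susp A) B = suspm (braid A B) ∘ suspl A B;
  suspl_suspr : forall A B : tt_tr,
    suspm (suspr A B) ∘ suspl A (susp B)
      = - (suspm (suspl A B) ∘ suspr (susp A) B);

  tens_exactl : forall (A B C T : tt_tr)
      (f : hom A B) (g : hom B C) (h : hom C (susp A)), exact_tri f g h ->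
    exact_tri (tensm (idm T) f) (tensm (idm T) g)
          (suspr T A ∘ tensm (idm T) h);
  tens_exactr : forall (A B C T : tt_tr)
      (f : hom A B) (g : hom B C) (h : hom C (susp A)), exact_tri f g h ->
    exact_tri (tensm f (idm T)) (tensm g (idm T))
          (suspl A T ∘ tensm h (idm T))
}.

Arguments tens {_}.
Arguments tensm {_ A B A' B'}.
Arguments unit_ob {_}.
Arguments assoc {_}.
Arguments assocV {_}.
Arguments lunit {_}.
Arguments lunitV {_}.
Arguments runit {_}.
Arguments runitV {_}.
Arguments braid {_}.
Arguments suspl {_}.
Arguments suspr {_}.
Notation "A ⊗ B" := (tens A B) : tt_scope.
Notation "f ⊠ g" := (tensm f g) : tt_scope.

Definition interchange (K : tt_category) (A B C E : K) :
    hom ((A ⊗ B) ⊗ (C ⊗ E)) ((A ⊗ C) ⊗ (B ⊗ E)) :=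
  assocV A C (B ⊗ E)
    ∘ (idm A ⊠ (assoc C B E ∘ (braid B C ⊠ idm E) ∘ assocV B C E))
    ∘ assoc A B (C ⊗ E).

Record duals (K : tt_category) := Duals {
  dual : K -> K;
  ev : forall A : K, hom (dual A ⊗ A) unit_ob;
  coev : forall A : K, hom unit_ob (A ⊗ dual A);
  ev_coev : forall A : K,
    runit A ∘ (idm A ⊠ ev A) ∘ assoc A (dual A) A ∘ (coev A ⊠ idm A)
      ∘ lunitV A = idm A;
  coev_ev : forall A : K,
    lunit (dual A) ∘ (ev A ⊠ idm (dual A)) ∘ assocV (dual A) A (dual A)
      ∘ (idm (dual A) ⊠ coev A) ∘ runitV (dual A) = idm (dual A)
}.

Section Duality.
Variables (K : tt_category) (D : duals K).

(* The morphism A -> DZ corresponding to a pairing A ⊗ Z -> 1. *)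
Definition transpose (A Z : K) (p : hom (A ⊗ Z) unit_ob) : hom A (dual D Z) :=
  lunit (dual D Z) ∘ (p ⊠ idm (dual D Z)) ∘ assocV A Z (dual D Z)
    ∘ (idm A ⊠ coev D Z) ∘ runitV A.

Definition dualm (A B : K) (f : hom A B) : hom (dual D B) (dual D A) :=
  transpose (ev D B ∘ (idm (dual D B) ⊠ f)).

Definition dual_tens (A B : K) : hom (dual D A ⊗ dual D B) (dual D (A ⊗ B)) :=
  transpose (lunit unit_ob ∘ (ev D A ⊠ ev D B)
               ∘ interchange (dual D A) (dual D B) A B).

(* Exactness of D : K^op -> K, where K^op is suspended by the inverse of the
   suspension of K; [t A] stands for the isomorphism between D(susp A) and the
   desuspension of DA.  Replacing [t] by [- t] exchanges the two sign
   conventions for the exact triangles of K^op. *)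
Definition dual_exact : Prop :=
  exists t : forall A : K, hom (dual D A) (susp (dual D (susp A))),
    [/\ forall A, is_iso (t A),
        forall (A B : K) (f : hom A B),
          suspm (dualm (suspm f)) ∘ t B = t A ∘ dualm f
      & forall (A B C : K) (f : hom A B) (g : hom B C) (h : hom C (susp A)),
          exact_tri f g h ->
          exact_tri (dualm g) (dualm f) (suspm (dualm h) ∘ t A)].

End Duality.

Section Spectrum.
Variable K : tt_category.

Record thick_tensor_ideal (P : K -> Prop) : Prop := ThickTensorIdeal {
  ideal_zero : forall Z : K, is_zero Z -> P Z;
  ideal_iso : forall A B : K, isomorphic A B -> P A -> P B;
  ideal_susp : forall A : K, P (susp A) <-> P A;
  ideal_exact : forall (A B C : K)
      (f : hom A B) (g : hom B C) (h : hom C (susp A)),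
    exact_tri f g h -> P A -> P B -> P C;
  ideal_summand : forall S A B : K, is_biproduct S A B -> P S -> P A;
  ideal_tens : forall A B : K, P B -> P (A ⊗ B)
}.

Record spc := Spc {
  prime_ideal :> K -> Prop;
  prime_thick : thick_tensor_ideal prime_ideal;
  prime_proper : exists A : K, ~ prime_ideal A;
  prime_tens : forall A B : K,
    prime_ideal (A ⊗ B) -> prime_ideal A \/ prime_ideal B
}.

Definition supp (A : K) (P : spc) : Prop := ~ P A.

End Spectrum.

Section EndoRing.
Variable K : tt_category.

Definition in_E (Z : K) : pred (hom Z Z) := fun f => f ⊠ idm Z == idm Z ⊠ f.

Definition E (Z : K) := {f : hom Z Z | in_E f}.

Definition mkE (Z : K) (f : hom Z Z) (Ef : in_E f) : E Z := exist _ f Ef.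

Implicit Types A B C Z W : K.

Lemma tens_split A B A' B' (f : hom A A') (g : hom B B') :
  (f ⊠ idm B') ∘ (idm A ⊠ g) = f ⊠ g.
Proof. by rewrite -tensmM compm1 comp1m. Qed.

Lemma tens_split' A B A' B' (f : hom A A') (g : hom B B') :
  (idm A' ⊠ g) ∘ (f ⊠ idm B) = f ⊠ g.
Proof. by rewrite -tensmM compm1 comp1m. Qed.

Lemma comp0m A B C (f : hom A B) : (0 : hom B C) ∘ f = 0.
Proof. by apply: (addrI (0 ∘ f)); rewrite -compDl !addr0. Qed.

Lemma compm0 A B C (f : hom B C) : f ∘ (0 : hom A B) = 0.
Proof. by apply: (addrI (f ∘ 0)); rewrite -compDr !addr0. Qed.

Lemma compNm A B C (f : hom B C) (g : hom A B) : (- f) ∘ g = - (f ∘ g).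
Proof. by apply: (addrI (f ∘ g)); rewrite -compDl !subrr comp0m. Qed.

Lemma tens0m A B A' B' (f : hom A A') : f ⊠ (0 : hom B B') = 0.
Proof. by apply: (addrI (f ⊠ 0)); rewrite -tensmDr !addr0. Qed.

Lemma tensm0 A B A' B' (f : hom B B') : (0 : hom A A') ⊠ f = 0.
Proof. by apply: (addrI (0 ⊠ f)); rewrite -tensmDl !addr0. Qed.

Lemma tensNm A B A' B' (f : hom A A') (g : hom B B') : (- f) ⊠ g = - (f ⊠ g).
Proof. by apply: (addrI (f ⊠ g)); rewrite -tensmDl !subrr tensm0. Qed.

Lemma tensmN A B A' B' (f : hom A A') (g : hom B B') : f ⊠ (- g) = - (f ⊠ g).
Proof. by apply: (addrI (f ⊠ g)); rewrite -tensmDr !subrr tens0m. Qed.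

Lemma iso_id A : is_iso (idm A).
Proof. by exists (idm A); split; rewrite comp1m. Qed.

Lemma iso_comp A B C (g : hom B C) (f : hom A B) :
  is_iso g -> is_iso f -> is_iso (g ∘ f).
Proof.
move=> [g' [g1 g2]] [f' [f1 f2]]; exists (f' ∘ g'); split.
  by rewrite -compA (compA g') g1 comp1m.
by rewrite -compA (compA f) f2 comp1m.
Qed.

Lemma iso_tens A B A' B' (f : hom A A') (g : hom B B') :
  is_iso f -> is_iso g -> is_iso (f ⊠ g).
Proof.
move=> [f' [f1 f2]] [g' [g1 g2]]; exists (f' ⊠ g').
by split; rewrite -tensmM ?f1 ?f2 ?g1 ?g2 tensm1.
Qed.

Lemma iso_assoc A B C : is_iso (assoc A B C).
Proof. by exists (assocV A B C); exact: assoc_inv. Qed.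

Lemma iso_assocV A B C : is_iso (assocV A B C).
Proof. by exists (assoc A B C); have [? ?] := assoc_inv A B C; split. Qed.

Lemma iso_braid A B : is_iso (braid A B).
Proof. by exists (braid B A); exact: braid_inv. Qed.

Lemma iso_interchange A B C C' : is_iso (interchange A B C C').
Proof.
apply: iso_comp (iso_comp _ _); first exact: iso_assocV; last exact: iso_assoc.
apply: iso_tens; first exact: iso_id.
apply: iso_comp (iso_comp _ _); first exact: iso_assoc; last exact: iso_assocV.
by apply: iso_tens; [exact: iso_braid | exact: iso_id].
Qed.

Lemma iso_inj A B C (u : hom B C) (f g : hom A B) :
  is_iso u -> u ∘ f = u ∘ g -> f = g.
Proof. by move=> [v [v1 _]] e; rewrite -[f]comp1m -v1 -compA e compA v1 comp1m. Qed.

Lemma iso_epi A B C (u : hom A B) (f g : hom B C) :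
  is_iso u -> f ∘ u = g ∘ u -> f = g.
Proof. by move=> [v [_ v2]] e; rewrite -[f]compm1 -v2 compA e -compA v2 compm1. Qed.

Lemma assocV_nat A B C A' B' C' (f : hom A A') (g : hom B B') (h : hom C C') :
  assocV A' B' C' ∘ (f ⊠ (g ⊠ h)) = ((f ⊠ g) ⊠ h) ∘ assocV A B C.
Proof.
apply: (iso_inj (iso_assoc A' B' C')); apply: (iso_epi (iso_assoc A B C)).
have [a1 a2] := assoc_inv A B C; have [a1' a2'] := assoc_inv A' B' C'.
rewrite [in LHS]compA a2' comp1m -!compA a1 compm1; symmetry.
exact: assoc_nat.
Qed.

Lemma interchange_nat A B C C' A1 B1 C1 C1' (f : hom A A1) (g : hom B B1)
    (h : hom C C1) (k : hom C' C1') :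
  interchange A1 B1 C1 C1' ∘ ((f ⊠ g) ⊠ (h ⊠ k))
    = ((f ⊠ h) ⊠ (g ⊠ k)) ∘ interchange A B C C'.
Proof.
rewrite /interchange -!compA assoc_nat.
rewrite (compA (idm A1 ⊠ _)) -tensmM comp1m.
have -> : (assoc C1 B1 C1' ∘ braid B1 C1 ⊠ idm C1' ∘ assocV B1 C1 C1')
            ∘ (g ⊠ (h ⊠ k))
        = (h ⊠ (g ⊠ k)) ∘ assoc C B C' ∘ (braid B C ⊠ idm C') ∘ assocV B C C'.
  rewrite -!compA assocV_nat (compA (braid _ _ ⊠ _)) -tensmM comp1m braid_nat.
  by rewrite -[k]compm1 tensmM compm1 compA compA assoc_nat -!compA.
rewrite -{1}[f]compm1 tensmM compA compA assocV_nat.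
by rewrite -!compA.
Qed.

Lemma E_conj A B (u : hom A B) (f : hom A A) (g : hom B B) :
  is_iso u -> u ∘ f = g ∘ u -> in_E f -> in_E g.
Proof.
move=> iu e /eqP Ef; apply/eqP; apply: (iso_epi (iso_tens iu iu)).
rewrite -!tensmM !comp1m -e.
transitivity ((u ⊠ u) ∘ (f ⊠ idm A)); first by rewrite -tensmM compm1.
by rewrite Ef -tensmM compm1.
Qed.

Lemma E_tens A B (f : hom A A) (g : hom B B) :
  in_E f -> in_E g -> in_E (f ⊠ g).
Proof.
move=> /eqP Ef /eqP Eg; apply/eqP; apply: (iso_inj (iso_interchange A B A B)).
by rewrite -tensm1 !interchange_nat Ef Eg.
Qed.

Lemma E0 Z : in_E (0 : hom Z Z).
Proof. by rewrite /in_E tens0m tensm0. Qed.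

Lemma E1 Z : in_E (idm Z).
Proof. by rewrite /in_E. Qed.

Lemma ED Z (f g : hom Z Z) : in_E f -> in_E g -> in_E (f + g).
Proof. by rewrite /in_E tensmDl tensmDr => /eqP-> /eqP->. Qed.

Lemma EN Z (f : hom Z Z) : in_E f -> in_E (- f).
Proof. by rewrite /in_E tensNm tensmN => /eqP->. Qed.

Lemma EM Z (f g : hom Z Z) : in_E f -> in_E g -> in_E (f ∘ g).
Proof.
move=> /eqP Ef /eqP Eg; apply/eqP.
transitivity ((f ⊠ idm Z) ∘ (g ⊠ idm Z)); first by rewrite -tensmM comp1m.
by rewrite Ef Eg -tensmM comp1m.
Qed.

Variable W : K.

(* [tpow n] is the tensor power of W of exponent n + 1, so that n ranges over
   all natural numbers when the exponent is required to be positive. *)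
Fixpoint tpow (n : nat) : K := if n is n'.+1 then W ⊗ tpow n' else W.

Fixpoint tpowD (m n : nat) : hom (tpow m ⊗ tpow n) (tpow (m + n).+1) :=
  if m is m'.+1 then (idm W ⊠ tpowD m' n) ∘ assoc W (tpow m') (tpow n)
  else idm (W ⊗ tpow n).

Fixpoint tpowDV (m n : nat) : hom (tpow (m + n).+1) (tpow m ⊗ tpow n) :=
  if m is m'.+1 then assocV W (tpow m') (tpow n) ∘ (idm W ⊠ tpowDV m' n)
  else idm (W ⊗ tpow n).

Lemma tpowD_inv m n : inverse_of (tpowD m n) (tpowDV m n).
Proof.
elim: m => [|m [IH1 IH2]] /=; first by split; rewrite comp1m.
have [a1 a2] := assoc_inv W (tpow m) (tpow n); split.
  by rewrite -compA (compA (idm W ⊠ _)) -tensmM IH1 comp1m tensm1 comp1m.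
by rewrite -compA (compA (assoc _ _ _)) a2 comp1m -tensmM IH2 comp1m tensm1.
Qed.

Lemma iso_tpowD m n : is_iso (tpowD m n).
Proof. by exists (tpowDV m n); exact: tpowD_inv. Qed.

(* Endomorphisms of W^m ⊗ W^n are seen as endomorphisms of W^(m+n) along the
   associativity isomorphism. *)
Definition flat m n (F : hom (tpow m ⊗ tpow n) (tpow m ⊗ tpow n)) :
    hom (tpow (m + n).+1) (tpow (m + n).+1) :=
  tpowD m n ∘ F ∘ tpowDV m n.

Lemma flatE m n (F : hom (tpow m ⊗ tpow n) (tpow m ⊗ tpow n)) :
  tpowD m n ∘ F = flat F ∘ tpowD m n.
Proof. by rewrite /flat -!compA (tpowD_inv m n).1 compm1. Qed.

Lemma E_flat m n (F : hom (tpow m ⊗ tpow n) (tpow m ⊗ tpow n)) :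
  in_E F -> in_E (flat F).
Proof. exact: E_conj (iso_tpowD m n) (flatE F). Qed.

Definition flat_endo m n (F : E (tpow m ⊗ tpow n)) : E (tpow (m + n).+1) :=
  mkE (E_flat (valP F)).

Definition E_addt A B (f : E A) (g : E B) : E (A ⊗ B) :=
  @mkE (A ⊗ B) (val f ⊠ idm B + idm A ⊠ val g)
    (ED (E_tens (valP f) (E1 B)) (E_tens (E1 A) (valP g))).

Definition E_mult A B (f : E A) (g : E B) : E (A ⊗ B) :=
  @mkE (A ⊗ B) ((val f ⊠ idm B) ∘ (idm A ⊠ val g))
    (EM (E_tens (valP f) (E1 B)) (E_tens (E1 A) (valP g))).

Definition E_tensr A B (f : E A) : E (A ⊗ B) :=
  @mkE (A ⊗ B) (val f ⊠ idm B) (E_tens (valP f) (E1 B)).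

Definition E_tensl A B (f : E B) : E (A ⊗ B) :=
  @mkE (A ⊗ B) (idm A ⊠ val f) (E_tens (E1 A) (valP f)).

Definition endo_pair := {n : nat & E (tpow n)}.
Definition Pair n (f : E (tpow n)) : endo_pair := existT _ n f.

Inductive stab_step : endo_pair -> endo_pair -> Prop :=
| stab_left m n (f : E (tpow n)) :
    stab_step (Pair f) (Pair (flat_endo (E_tensl (tpow m) f)))
| stab_right m n (f : E (tpow n)) :
    stab_step (Pair f) (Pair (flat_endo (E_tensr (tpow m) f))).

Definition stab_rel : rel endo_pair :=
  fun p q => `[< clos_refl_sym_trans endo_pair stab_step p q >].

Lemma stab_rel_refl : reflexive stab_rel.
Proof. by move=> p; apply/asboolP; exact: rst_refl. Qed.

Lemma stab_rel_sym : symmetric stab_rel.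
Proof. by move=> p q; apply/asboolP/asboolP; exact: rst_sym. Qed.

Lemma stab_rel_trans : transitive stab_rel.
Proof.
by move=> q p r /asboolP pq /asboolP qr; apply/asboolP; exact: rst_trans pq qr.
Qed.

Canonical stab_equiv :=
  EquivRel stab_rel stab_rel_refl stab_rel_sym stab_rel_trans.

Definition endo_ring := {eq_quot stab_equiv}.
HB.instance Definition _ := Choice.on endo_ring.
HB.instance Definition _ := EqQuotient.on endo_ring.

Definition cls n (f : E (tpow n)) : endo_ring := \pi_endo_ring (Pair f).

Lemma cls_left m n (f : E (tpow n)) :
  cls (flat_endo (E_tensl (tpow m) f)) = cls f.
Proof.
apply/esym/eqmodP/asboolP/rst_step; exact: stab_left.
Qed.

Lemma cls_right m n (f : E (tpow n)) :
  cls (flat_endo (E_tensr (tpow m) f)) = cls f.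
Proof.
apply/esym/eqmodP/asboolP/rst_step; exact: stab_right.
Qed.

Lemma cls_conj m n (f : E (tpow m)) (g : E (tpow n))
    (u : hom (tpow m) (tpow n)) :
  is_iso u -> u ∘ val f = val g ∘ u -> cls f = cls g.
Proof.
move=> iu e; rewrite -(cls_right n f) -(cls_left m g).
congr (cls _); apply: val_inj => /=; congr flat.
apply: (iso_inj (iso_tens iu (iso_id _))).
rewrite -!tensmM !comp1m e compm1 -(tens_split u) -{1}[idm (tpow n)]comp1m tensmM.
by rewrite (eqP (valP g)) tens_split' tens_split.
Qed.

Let op (b : bool) A (F G : hom A A) : hom A A := if b then F + G else F ∘ G.

Let E_op b A (F G : hom A A) : in_E F -> in_E G -> in_E (op b F G).
Proof. by case: b; [exact: ED | exact: EM]. Qed.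

Let op_conj b A B (u : hom A B) (F G : hom A A) (F' G' : hom B B) :
  u ∘ F = F' ∘ u -> u ∘ G = G' ∘ u -> u ∘ op b F G = op b F' G' ∘ u.
Proof.
case: b => /= e1 e2; first by rewrite compDr compDl e1 e2.
by rewrite compA e1 -compA e2 compA.
Qed.

Let op_tensl b A B (F G : hom B B) :
  idm A ⊠ op b F G = op b (idm A ⊠ F) (idm A ⊠ G).
Proof. by case: b; rewrite /= ?tensmDr // -tensmM comp1m. Qed.

Let opt b A B (f : E A) (g : E B) : E (A ⊗ B) :=
  @mkE (A ⊗ B) (op b (val f ⊠ idm B) (idm A ⊠ val g))
    (E_op b (E_tens (valP f) (E1 B)) (E_tens (E1 A) (valP g))).

Let cop b m n (f : E (tpow m)) (g : E (tpow n)) : endo_ring :=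
  cls (flat_endo (opt b f g)).

Let cls_flat_conj m n m' n' (F : E (tpow m ⊗ tpow n)) (G : E (tpow m' ⊗ tpow n'))
    (u : hom (tpow m ⊗ tpow n) (tpow m' ⊗ tpow n')) :
  is_iso u -> u ∘ val F = val G ∘ u -> cls (flat_endo F) = cls (flat_endo G).
Proof.
move=> iu e; apply: (@cls_conj _ _ _ _ (tpowD m' n' ∘ u ∘ tpowDV m n)).
  apply: iso_comp; first exact: iso_tpowD.
  apply: iso_comp iu _; exists (tpowD m n); have [? ?] := tpowD_inv m n; by split.
rewrite /= /flat -!compA (compA (tpowDV m n)) (tpowD_inv m n).1 comp1m.
by rewrite (compA (tpowDV m' n')) (tpowD_inv m' n').1 comp1m (compA u) e -!compA.
Qed.

Let copC b m n (f : E (tpow m)) (g : E (tpow n)) : cop b f g = cop b g f.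
Proof.
apply: (cls_flat_conj (iso_braid _ _)); rewrite /=.
have -> : op b (val g ⊠ idm (tpow m)) (idm (tpow n) ⊠ val f)
        = op b (idm (tpow n) ⊠ val f) (val g ⊠ idm (tpow m)).
  by case: b => /=; [rewrite addrC | rewrite tens_split tens_split'].
by apply: op_conj; rewrite braid_nat.
Qed.

Let cop_conj b k m n m' (f : E (tpow m)) (f' : E (tpow m')) (g : E (tpow n))
    (u : hom (tpow k ⊗ tpow m) (tpow m')) :
  is_iso u -> u ∘ (idm (tpow k) ⊠ val f) = val f' ∘ u -> cop b f g = cop b f' g.
Proof.
move=> iu e; rewrite /cop -(cls_left k).
pose w := tpowD m' n ∘ (u ⊠ idm (tpow n)) ∘ assocV _ _ _
            ∘ (idm (tpow k) ⊠ tpowDV m n) ∘ tpowDV k (m + n).+1.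
have iV i j : is_iso (tpowDV i j).
  by exists (tpowD i j); have [? ?] := tpowD_inv i j; split.
apply: (@cls_conj _ _ _ _ w).
  apply: iso_comp (iso_tpowD _ _) _; apply: iso_comp.
    exact: iso_tens iu (iso_id _).
  apply: iso_comp (iso_assocV _ _ _) _.
  by apply: iso_comp (iV _ _); apply: iso_tens (iso_id _) (iV _ _).
rewrite /w /= /flat -!compA (compA (tpowDV k _)) (tpowD_inv k _).1 comp1m.
rewrite (compA (idm _ ⊠ _)) -tensmM comp1m !compA (tpowD_inv m n).1 comp1m.
rewrite -(compA _ (tpowDV m' n)) (tpowD_inv m' n).1 compm1.
congr (_ ∘ _); rewrite -!compA; congr (_ ∘ _).
have -> : idm (tpow k) ⊠ (op b (val f ⊠ idm (tpow n)) (idm (tpow m) ⊠ val g)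
             ∘ tpowDV m n)
  = (idm (tpow k) ⊠ op b (val f ⊠ idm (tpow n)) (idm (tpow m) ⊠ val g))
     ∘ (idm (tpow k) ⊠ tpowDV m n) by rewrite -tensmM comp1m.
rewrite !compA; congr (_ ∘ _); rewrite op_tensl.
rewrite -[RHS]compA; apply: op_conj; rewrite -compA assocV_nat !compA -!tensmM.
  by rewrite e comp1m.
by rewrite tensm1 !comp1m !compm1.
Qed.

Let cop_cls b m m' n (f : E (tpow m)) (f' : E (tpow m')) (g : E (tpow n)) :
  cls f = cls f' -> cop b f g = cop b f' g.
Proof.
pose h (p : endo_pair) := cop b (projT2 p) g.
suff hh p q : clos_refl_sym_trans _ stab_step p q -> h p = h q.
  by move=> /eqmodP/asboolP/hh.
elim=> {p q} [_ _ [k i a|k i a]|//|p q _ //|p q r _ -> _ -> //].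
  apply: (cop_conj _ _ (iso_tpowD k i)) => /=; exact: flatE.
have iu : is_iso (tpowD i k ∘ braid (tpow k) (tpow i)).
  by apply: iso_comp; [exact: iso_tpowD | exact: iso_braid].
by apply: (cop_conj _ _ iu); rewrite /= -compA braid_nat !compA flatE.
Qed.

Let cop_same b n (f g : E (tpow n)) :
  cop b f g = cls (mkE (E_op b (valP f) (valP g))).
Proof.
rewrite -(cls_left n); congr (cls _); apply: val_inj => /=; congr flat.
by rewrite op_tensl (eqP (valP f)).
Qed.

Definition endo_add (x y : endo_ring) : endo_ring :=
  cls (flat_endo (E_addt (projT2 (repr x)) (projT2 (repr y)))).
Definition endo_mul (x y : endo_ring) : endo_ring :=
  cls (flat_endo (E_mult (projT2 (repr x)) (projT2 (repr y)))).
Definition endo_opp (x : endo_ring) : endo_ring :=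
  cls (mkE (EN (valP (projT2 (repr x))))).
Definition endo_zero : endo_ring := cls (mkE (E0 (tpow 0))).
Definition endo_one : endo_ring := cls (mkE (E1 (tpow 0))).

Let cls_repr (x : endo_ring) : cls (projT2 (repr x)) = x.
Proof. by rewrite -[RHS]reprK /cls; case: (repr x). Qed.

Let cop_cls2 b m m' n n' (f : E (tpow m)) (f' : E (tpow m')) (g : E (tpow n))
    (g' : E (tpow n')) :
  cls f = cls f' -> cls g = cls g' -> cop b f g = cop b f' g'.
Proof. by move=> e1 e2; rewrite (cop_cls _ _ e1) copC (cop_cls _ _ e2) copC. Qed.

Let flat_endoinj m n (F G : E (tpow m ⊗ tpow n)) :
  val F = val G -> cls (flat_endo F) = cls (flat_endo G).
Proof. by move=> /val_inj ->. Qed.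

Lemma endo_addE m n (f : E (tpow m)) (g : E (tpow n)) :
  endo_add (cls f) (cls g) = cls (flat_endo (E_addt f g)).
Proof.
have := cop_cls2 true (cls_repr (cls f)) (cls_repr (cls g)); rewrite /cop => e.
transitivity (cls (flat_endo (opt true f g))); last exact: flat_endoinj.
by rewrite -e; apply: flat_endoinj.
Qed.

Lemma endo_mulE m n (f : E (tpow m)) (g : E (tpow n)) :
  endo_mul (cls f) (cls g) = cls (flat_endo (E_mult f g)).
Proof.
have := cop_cls2 false (cls_repr (cls f)) (cls_repr (cls g)); rewrite /cop => e.
transitivity (cls (flat_endo (opt false f g))); last exact: flat_endoinj.
by rewrite -e; apply: flat_endoinj.
Qed.

Lemma endo_add_same n (f g : E (tpow n)) :
  endo_add (cls f) (cls g)
    = cls (mkE (ED (valP f) (valP g))).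
Proof.
rewrite endo_addE; transitivity (cop true f g); first exact: flat_endoinj.
by rewrite cop_same; congr (cls _); apply: val_inj.
Qed.

Lemma endo_mul_same n (f g : E (tpow n)) :
  endo_mul (cls f) (cls g)
    = cls (mkE (EM (valP f) (valP g))).
Proof.
rewrite endo_mulE; transitivity (cop false f g); first exact: flat_endoinj.
by rewrite cop_same; congr (cls _); apply: val_inj.
Qed.

Lemma endo_ring_ind (P : endo_ring -> Prop) :
  (forall n (f : E (tpow n)), P (cls f)) -> forall x, P x.
Proof. by move=> H x; rewrite -[x]cls_repr. Qed.

Lemma endo_ring_ind2 (P : endo_ring -> endo_ring -> Prop) :
  (forall n (f g : E (tpow n)), P (cls f) (cls g)) -> forall x y, P x y.
Proof.
move=> H x y; move: x; apply: endo_ring_ind => m f.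
move: y; apply: endo_ring_ind => n g.
by rewrite -(cls_right n f) -(cls_left m g).
Qed.

Lemma endo_ring_ind3 (P : endo_ring -> endo_ring -> endo_ring -> Prop) :
  (forall n (f g h : E (tpow n)), P (cls f) (cls g) (cls h)) ->
  forall x y z, P x y z.
Proof.
move=> H x y z; move: x y; apply: endo_ring_ind2 => m f g.
move: z; apply: endo_ring_ind => n h.
by rewrite -(cls_right n f) -(cls_right n g) -(cls_left m h).
Qed.

Let cls_eq n (f g : E (tpow n)) : val f = val g -> cls f = cls g.
Proof. by move=> /val_inj ->. Qed.

Let zeroE n : endo_zero = cls (mkE (E0 (tpow n))).
Proof.
rewrite /endo_zero -[LHS](cls_right n).
rewrite -[RHS](cls_left 0); apply: cls_eq => /=.
by congr flat; rewrite tens0m tensm0.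
Qed.

Let oneE n : endo_one = cls (mkE (E1 (tpow n))).
Proof. by rewrite /endo_one -[LHS](cls_right n) -[RHS](cls_left 0); apply: cls_eq. Qed.

Let endo_addA : associative endo_add.
Proof.
apply: endo_ring_ind3 => n f g h; rewrite !endo_add_same.
by apply: cls_eq; rewrite /= addrA.
Qed.

Let endo_addC : commutative endo_add.
Proof.
apply: endo_ring_ind2 => n f g; rewrite !endo_add_same.
by apply: cls_eq; rewrite /= addrC.
Qed.

Let endo_add0 : left_id endo_zero endo_add.
Proof.
apply: endo_ring_ind => n f; rewrite (zeroE n) endo_add_same.
by apply: cls_eq; rewrite /= add0r.
Qed.

Let endo_addN : left_inverse endo_zero endo_opp endo_add.
Proof.
move=> x; rewrite -{2}[x]cls_repr /endo_opp endo_add_same.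
by rewrite (zeroE (projT1 (repr x))); apply: cls_eq; rewrite /= addNr.
Qed.

HB.instance Definition _ :=
  GRing.isZmodule.Build endo_ring endo_addA endo_addC endo_add0 endo_addN.

Let endo_mulA : associative endo_mul.
Proof.
apply: endo_ring_ind3 => n f g h; rewrite !endo_mul_same.
by apply: cls_eq; rewrite /= compA.
Qed.

Let endo_mulC : commutative endo_mul.
Proof.
apply: endo_ring_ind2 => n f g; rewrite !endo_mulE.
have e := copC false f g; rewrite /cop in e.
transitivity (cls (flat_endo (opt false f g))); first exact: flat_endoinj.
by rewrite e; exact: flat_endoinj.
Qed.

Let endo_mul1 : left_id endo_one endo_mul.
Proof.
apply: endo_ring_ind => n f; rewrite (oneE n) endo_mul_same.
by apply: cls_eq; rewrite /= comp1m.
Qed.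

Let endo_mulD : left_distributive endo_mul endo_add.
Proof.
apply: endo_ring_ind3 => n f g h; rewrite endo_add_same !endo_mul_same.
by rewrite endo_add_same; apply: cls_eq; rewrite /= compDl.
Qed.

HB.instance Definition _ :=
  GRing.Zmodule_isComPzRing.Build endo_ring
    endo_mulA endo_mulC endo_mul1 endo_mulD.

(* The point of Spec(R_W) attached to P, given by its underlying subset of R_W;
   meaningful for P in the support of W. *)
Definition rho (P : spc K) (r : endo_ring) : Prop :=
  exists n (f : E (tpow n)) (C : K), [/\ r = cls f, is_cone (val f) C & ~ P C].

End EndoRing.

(* [g] is [f] regarded as an endomorphism of [A] along [u]. *)
Definition regarded_along (K : tt_category) (A B : K) (u : hom A B)
    (f : hom B B) (g : hom A A) : Prop :=
  is_iso u /\ u ∘ g = f ∘ u.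

Fixpoint dual_tpow (K : tt_category) (D : duals K) (X : K) (n : nat) :
    hom (tpow (dual D X) n) (dual D (tpow X n)) :=
  if n is n'.+1 then
    dual_tens D X (tpow X n') ∘ (idm (dual D X) ⊠ dual_tpow D X n')
  else idm (dual D X).

(* Main.v *)
(* Transposition along ev and coev makes D fully faithful, and exhibits
   DA ⊗ DB -> D(A ⊗ B) as an isomorphism by the Yoneda lemma: up to a braiding,
   its pairing with A ⊗ B is the iterated adjunction pairing, which is perfect.
   Hence f |-> Df is a bijection from E_(X^n) to E_((DX)^n) along
   (DX)^n = D(X^n).  Classes in R_W depend only on endomorphisms of tensor
   powers up to conjugation by arbitrary isomorphisms, so compatibility with
   the stabilization maps only needs the naturality of this isomorphism, and
   contravariance of D is harmless because the rings are commutative.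
   For the comparison with rho, the cone of Df is a shift of D(cone f), and a
   thick tensor ideal contains C if and only if it contains DC, as C is a
   retract of C ⊗ DC ⊗ C and DC one of DC ⊗ C ⊗ DC. *)
Require Import Defs.
From HB Require Import structures.
From mathcomp Require Import all_boot all_algebra.
From mathcomp Require Import boolp.
From Stdlib Require Import Relation_Operators.
Import Defs.
Set Implicit Arguments.
Unset Strict Implicit.
Unset Printing Implicit Defensive.
Import GRing.Theory.
Local Open Scope ring_scope.
Local Open Scope tt_scope.

(** * Rewriting and zero rules for composition in a preadditive category *)

Section Category.
Variable K : preadditive_category.
Implicit Types A B C T : K.

(** Composites associate to the right, so an equation about [g ∘ f] does not match inside a longer
    one. This lemma and the next two carry the tail [k] along. *)
Lemma compAl A B B' C T (g : hom B C) (f : hom A B) (g' : hom B' C)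
    (f' : hom A B') (k : hom T A) :
  g ∘ f = g' ∘ f' -> g ∘ f ∘ k = g' ∘ f' ∘ k.
Proof. by move=> e; rewrite !compA e. Qed.

Lemma compAlm A B C T (g : hom B C) (f : hom A B) (h : hom A C)
    (k : hom T A) : g ∘ f = h -> g ∘ f ∘ k = h ∘ k.
Proof. by move=> <-; rewrite compA. Qed.

Lemma compAl1 A B T (g : hom B A) (f : hom A B) (k : hom T A) :
  g ∘ f = idm A -> g ∘ f ∘ k = k.
Proof. by move=> e; rewrite (compAlm _ e) comp1m. Qed.

Lemma comp0r A B C (f : hom A B) : (0 : hom B C) ∘ f = 0.
Proof. by apply: (addrI (0 ∘ f)); rewrite -compDl !addr0. Qed.

Lemma compr0 A B C (f : hom B C) : f ∘ (0 : hom A B) = 0.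
Proof. by apply: (addrI (f ∘ 0)); rewrite -compDr !addr0. Qed.

Lemma compNr A B C (g : hom B C) (f : hom A B) : (- g) ∘ f = - (g ∘ f).
Proof. by apply: (addrI (g ∘ f)); rewrite -compDl !subrr comp0r. Qed.

Lemma comprN A B C (g : hom B C) (f : hom A B) : g ∘ (- f) = - (g ∘ f).
Proof. by apply: (addrI (g ∘ f)); rewrite -compDr !subrr compr0. Qed.

End Category.

(** * Coherence of units, associators and braiding *)

Section Monoidal.
Variable K : tt_category.
Implicit Types A B C T : K.

Local Notation "1" := (@unit_ob K).

Lemma tensl_comp T A B C (g : hom B C) (f : hom A B) :
  idm T ⊠ (g ∘ f) = (idm T ⊠ g) ∘ (idm T ⊠ f).
Proof. by rewrite -tensmM comp1m. Qed.

Lemma tensr_comp T A B C (g : hom B C) (f : hom A B) :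
  (g ∘ f) ⊠ idm T = (g ⊠ idm T) ∘ (f ⊠ idm T).
Proof. by rewrite -tensmM comp1m. Qed.

Lemma tens_swap A B A' B' (f : hom A A') (g : hom B B') :
  (f ⊠ idm B') ∘ (idm A ⊠ g) = (idm A' ⊠ g) ∘ (f ⊠ idm B).
Proof. by rewrite tens_split tens_split'. Qed.

Lemma lunitVK A : lunit A ∘ lunitV A = idm A.
Proof. exact: (lunit_inv A).2. Qed.

Lemma runitVK A : runit A ∘ runitV A = idm A.
Proof. exact: (runit_inv A).2. Qed.

Lemma assocK A B C : assocV A B C ∘ assoc A B C = idm ((A ⊗ B) ⊗ C).
Proof. exact: (assoc_inv A B C).1. Qed.

Lemma assocVK A B C : assoc A B C ∘ assocV A B C = idm (A ⊗ (B ⊗ C)).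
Proof. exact: (assoc_inv A B C).2. Qed.

Lemma iso_lunit A : is_iso (lunit A).
Proof. by exists (lunitV A); exact: lunit_inv. Qed.

Lemma iso_runit A : is_iso (runit A).
Proof. by exists (runitV A); exact: runit_inv. Qed.

Lemma lunitV_nat A B (f : hom A B) :
  lunitV B ∘ f = (idm 1 ⊠ f) ∘ lunitV A.
Proof.
apply: (iso_inj (iso_lunit B)).
by rewrite (compAl1 _ (lunitVK B)) (compAl _ (lunit_nat f)) lunitVK compm1.
Qed.

Lemma runitV_nat A B (f : hom A B) :
  runitV B ∘ f = (f ⊠ idm 1) ∘ runitV A.
Proof.
apply: (iso_inj (iso_runit B)).
by rewrite (compAl1 _ (runitVK B)) (compAl _ (runit_nat f)) runitVK compm1.
Qed.

Lemma tens1_inj A B (f g : hom A B) : idm 1 ⊠ f = idm 1 ⊠ g -> f = g.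
Proof.
by move=> e; apply: (iso_epi (iso_lunit A)); rewrite -!lunit_nat e.
Qed.

Lemma tensr1_inj A B (f g : hom A B) : f ⊠ idm 1 = g ⊠ idm 1 -> f = g.
Proof.
by move=> e; apply: (iso_epi (iso_runit A)); rewrite -!runit_nat e.
Qed.

(* Kelly: in a monoidal category this and the next two equations follow from
   the triangle and the pentagon. *)
Lemma lunit_tens A B : lunit (A ⊗ B) ∘ assoc 1 A B = lunit A ⊠ idm B.
Proof.
apply: tens1_inj; rewrite tensl_comp.
apply: (iso_epi (iso_assoc 1 (1 ⊗ A) B)).
apply: (iso_epi (iso_tens (iso_assoc 1 1 A) (iso_id B))).
rewrite -!compA -pentagon compA triangle -tensm1 -assoc_nat.
rewrite [RHS]compA -assoc_nat -!compA; congr (_ ∘ _).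
by rewrite -tensmM triangle comp1m.
Qed.

Lemma runit_tens A B : runit (A ⊗ B) = (idm A ⊠ runit B) ∘ assoc A B 1.
Proof.
apply: tensr1_inj; apply: (iso_inj (iso_assoc A B 1)).
have e : assoc A B 1 ∘ (idm (A ⊗ B) ⊠ lunit 1)
           = (idm A ⊠ (idm B ⊠ lunit 1)) ∘ assoc A B (1 ⊗ 1).
  by rewrite -tensm1 assoc_nat.
rewrite -triangle (compAl _ e) pentagon.
rewrite (compAlm _ (esym (tensl_comp _ _ _))) triangle.
by rewrite tensr_comp (compAl _ (assoc_nat _ _ _)).
Qed.

Lemma lunit_runit1 : lunit 1 = runit 1.
Proof.
apply: tensr1_inj; rewrite -lunit_tens -triangle; congr (_ ∘ _).
by apply: (iso_inj (iso_lunit 1)); rewrite lunit_nat.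
Qed.

(** This is the hexagon for [A], [1], [1]: naturality and the triangle reduce it to the claim
    tensored with [1] and composed with the invertible [braid A 1], and both can be cancelled. *)
Lemma lunit_braid A : lunit A ∘ braid A 1 = runit A.
Proof.
apply: tensr1_inj; apply: (iso_inj (iso_braid A 1)).
transitivity (lunit (1 ⊗ A) ∘ (idm 1 ⊠ braid A 1) ∘ assoc 1 A 1
              ∘ (braid A 1 ⊠ idm 1)).
  rewrite (compAl _ (lunit_nat _)) (compAlm _ (lunit_tens _ _)).
  by rewrite -tensr_comp.
rewrite -hexagon (compAlm _ (lunit_tens _ _)) (compAl _ (esym (braid_nat _ _))).
by rewrite triangle.
Qed.

End Monoidal.

(** * Duality as an adjunction; full faithfulness and monoidality of [D] *)

Section Dual.
Variables (K : tt_category) (D : duals K).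
Implicit Types A B C T : K.

Local Notation "1" := (@unit_ob K).

(** Counit of the adjunction between [- ⊗ A] and [- ⊗ DA]; [coevr] is the unit, and [evr_coevr] and
    [coevr_evr] are the triangle identities, obtained by tensoring those of [A] on the left. *)
Definition evr C A : hom ((C ⊗ dual D A) ⊗ A) C :=
  runit C ∘ (idm C ⊠ ev D A) ∘ assoc C (dual D A) A.

Definition coevr T A : hom T ((T ⊗ A) ⊗ dual D A) :=
  assocV T A (dual D A) ∘ (idm T ⊠ coev D A) ∘ runitV T.

Lemma evr_nat A B C (w : hom B C) :
  evr C A ∘ ((w ⊠ idm (dual D A)) ⊠ idm A) = w ∘ evr B A.
Proof.
rewrite /evr -!compA assoc_nat tensm1 (compAl _ (esym (tens_swap _ _))).
by rewrite (compAl _ (runit_nat _)).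
Qed.

Lemma coevr_nat A B T (v : hom B T) :
  coevr T A ∘ v = ((v ⊠ idm A) ⊠ idm (dual D A)) ∘ coevr B A.
Proof.
rewrite /coevr -!compA runitV_nat (compAl _ (esym (tens_swap _ _))).
by rewrite -tensm1 (compAl _ (assocV_nat _ _ _)).
Qed.

Lemma runitV_tens A B : runitV (A ⊗ B) = assocV A B 1 ∘ (idm A ⊠ runitV B).
Proof.
apply: (iso_inj (iso_runit _)); rewrite runitVK runit_tens -!compA.
by rewrite (compAl1 _ (assocVK _ _ _)) -tensl_comp runitVK tensm1.
Qed.

Lemma triangleV A B :
  assocV A 1 B ∘ (idm A ⊠ lunitV B) = runitV A ⊠ idm B.
Proof.
apply: (iso_inj (iso_tens (iso_runit A) (iso_id B))).
rewrite -tensr_comp runitVK -triangle -!compA (compAl1 _ (assocVK _ _ _)).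
by rewrite -tensl_comp lunitVK.
Qed.

Lemma pentagon1 A B C T :
  assoc A (B ⊗ C) T ∘ (assoc A B C ⊠ idm T) ∘ assocV (A ⊗ B) C T
    = (idm A ⊠ assocV B C T) ∘ assoc A B (C ⊗ T).
Proof.
apply: (iso_epi (iso_assoc (A ⊗ B) C T)); rewrite -!compA assocK compm1 pentagon.
by rewrite (compAlm _ (esym (tensl_comp _ _ _))) assocK tensm1 comp1m.
Qed.

Lemma pentagon2 A B C T :
  assoc A B (C ⊗ T) ∘ assoc (A ⊗ B) C T ∘ (assocV A B C ⊠ idm T)
    = (idm A ⊠ assoc B C T) ∘ assoc A (B ⊗ C) T.
Proof.
rewrite (compAlm _ (pentagon _ _ _ _)) -!compA -tensr_comp assocVK tensm1.
by rewrite compm1.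
Qed.

Lemma evr_coevr C A :
  (evr C A ⊠ idm (dual D A)) ∘ coevr (C ⊗ dual D A) A = idm (C ⊗ dual D A).
Proof.
rewrite -[in RHS](tensm1 C) -[in RHS](coev_ev D A) !tensl_comp.
rewrite /evr /coevr runitV_tens !tensr_comp -triangle -!compA.
congr (_ ∘ _); rewrite (compAl _ (assoc_nat _ _ _)); congr (_ ∘ _).
rewrite -tensm1 (compAl _ (esym (assocV_nat _ _ _))) !compA; do 2!congr (_ ∘ _).
by rewrite -[_ ∘ assocV _ A _]compA pentagon1 -compA assocVK compm1.
Qed.

Lemma coevr_evr T A :
  evr (T ⊗ A) A ∘ (coevr T A ⊠ idm A) = idm (T ⊗ A).
Proof.
rewrite -[in RHS](tensm1 T) -[in RHS](ev_coev D A) !tensl_comp.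
rewrite /evr /coevr runit_tens !tensr_comp -triangleV -!compA.
congr (_ ∘ _); rewrite -tensm1 (compAl _ (assoc_nat _ _ _)); congr (_ ∘ _).
rewrite (compAl _ (esym (assocV_nat _ _ _))) !compA; do 2!congr (_ ∘ _).
by rewrite -[(_ ∘ _) ∘ (_ ⊠ _)]compA pentagon2 -compA assocVK compm1.
Qed.

(* The adjunction between [- ⊗ A] and [- ⊗ DA]. *)
Lemma evr_bij T A C :
  bijective (fun v : hom T (C ⊗ dual D A) => evr C A ∘ (v ⊠ idm A)).
Proof.
exists (fun w => (w ⊠ idm (dual D A)) ∘ coevr T A) => [v|w].
  by rewrite tensr_comp -compA -coevr_nat compA evr_coevr comp1m.
by rewrite tensr_comp compA evr_nat -compA coevr_evr compm1.
Qed.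

Lemma evr_unit A : evr 1 A = ev D A ∘ (lunit (dual D A) ⊠ idm A).
Proof.
rewrite /evr -lunit_runit1 -lunit_tens !compA; congr (_ ∘ _).
by rewrite lunit_nat.
Qed.

Lemma transposeE A B (p : hom (A ⊗ B) 1) :
  transpose D p = lunit (dual D B) ∘ (p ⊠ idm (dual D B)) ∘ coevr A B.
Proof. by []. Qed.

Lemma transposeK A B (p : hom (A ⊗ B) 1) :
  ev D B ∘ (transpose D p ⊠ idm B) = p.
Proof.
rewrite transposeE 2!tensr_comp (compA (ev D B)) -evr_unit compA evr_nat -compA.
by rewrite coevr_evr compm1.
Qed.

Lemma ev_transpose A B (u : hom A (dual D B)) :
  transpose D (ev D B ∘ (u ⊠ idm B)) = u.
Proof.
rewrite transposeE tensr_comp -!compA -coevr_nat.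
rewrite -[RHS]comp1m -[in RHS](coev_ev D B).
by rewrite !compA.
Qed.

(** Equations between maps into a dual are checked on the associated pairings; functoriality,
    additivity and monoidality of [dualm] are proved this way. *)
Lemma ev_inj A B (u v : hom A (dual D B)) :
  ev D B ∘ (u ⊠ idm B) = ev D B ∘ (v ⊠ idm B) -> u = v.
Proof. by move=> e; rewrite -[u]ev_transpose e ev_transpose. Qed.

Lemma ev_dualm A B (f : hom A B) :
  ev D A ∘ (dualm D f ⊠ idm A) = ev D B ∘ (idm (dual D B) ⊠ f).
Proof. exact: transposeK. Qed.

Lemma dualm1 A : dualm D (idm A) = idm (dual D A).
Proof. by apply: ev_inj; rewrite ev_dualm. Qed.

Lemma dualmM A B C (g : hom B C) (f : hom A B) :
  dualm D (g ∘ f) = dualm D f ∘ dualm D g.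
Proof.
apply: ev_inj; rewrite ev_dualm tensl_comp tensr_comp (compAl _ (ev_dualm f)).
by rewrite -tens_swap (compAl _ (ev_dualm g)).
Qed.

Lemma dualmD A B (f g : hom A B) : dualm D (f + g) = dualm D f + dualm D g.
Proof.
by apply: ev_inj; rewrite ev_dualm tensmDl tensmDr !compDr !ev_dualm.
Qed.

(** The opposite transposition [A -> B ⊗ DB ⊗ A -> B], which serves as the inverse of [dualm] on
    morphisms. *)
Definition undual A B (h : hom (dual D B) (dual D A)) : hom A B :=
  runit B ∘ (idm B ⊠ (ev D A ∘ (h ⊠ idm A))) ∘ assoc B (dual D B) A
    ∘ (coev D B ⊠ idm A) ∘ lunitV A.

Lemma dualmK A B : cancel (@dualm K D A B) (@undual A B).
Proof.
move=> f; rewrite /undual ev_dualm tensl_comp -!compA.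
rewrite -(compAl _ (assoc_nat _ _ _)) tensm1 -(compAl _ (tens_swap _ _)).
by rewrite -lunitV_nat -[RHS]comp1m -[in RHS](ev_coev D B) -!compA.
Qed.

Lemma undualK A B : cancel (@undual A B) (@dualm K D A B).
Proof.
move=> h; apply: ev_inj; rewrite ev_dualm /undual.
(* Only the pairing [p] on [DB ⊗ A] matters: it slides past [ev D B] until what remains is [coev_ev]
   tensored with [A]. *)
move: (ev D A ∘ _) => p.
rewrite !tensl_comp.
have e : ev D B ∘ (idm (dual D B) ⊠ runit B)
  = runit 1 ∘ (ev D B ⊠ idm 1) ∘ assocV (dual D B) B 1.
  rewrite (compAlm _ (runit_nat _)) runit_tens -!compA assocVK compm1 //.
rewrite (compAl _ e) -!compA (compAl _ (assocV_nat _ _ _)) tensm1.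
rewrite (compAl _ (tens_swap _ _)) -lunit_runit1 (compAl _ (lunit_nat _)).
rewrite -[RHS]compm1; congr (_ ∘ _).
rewrite -[RHS]tensm1 -[in RHS](coev_ev D B) !tensr_comp.
rewrite -triangleV -lunit_tens -!compA; congr (_ ∘ _).
rewrite (compAl _ (assoc_nat _ _ _)) tensm1; congr (_ ∘ _).
rewrite -(compAl _ (assocV_nat _ _ _)).
apply: (iso_inj (iso_assoc (dual D B) B (dual D B ⊗ A))).
rewrite (compAl1 _ (assocVK _ _ _)) !compA; do 2!congr (_ ∘ _).
by rewrite -[(_ ∘ _) ∘ (_ ⊠ _)]compA pentagon2 -compA assocVK compm1.
Qed.

Lemma dualm_inj A B : injective (@dualm K D A B).
Proof. exact: can_inj (@dualmK A B). Qed.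

Definition dual_pairing A B : hom ((dual D A ⊗ dual D B) ⊗ (A ⊗ B)) 1 :=
  lunit 1 ∘ (ev D A ⊠ ev D B) ∘ interchange (dual D A) (dual D B) A B.

Lemma ev_dual_tens A B :
  ev D (A ⊗ B) ∘ (dual_tens D A B ⊠ idm (A ⊗ B)) = dual_pairing A B.
Proof. exact: transposeK. Qed.

Lemma dual_tens_nat A B A' B' (f : hom A A') (g : hom B B') :
  dualm D (f ⊠ g) ∘ dual_tens D A' B'
    = dual_tens D A B ∘ (dualm D f ⊠ dualm D g).
Proof.
apply: ev_inj.
rewrite (tensr_comp _ (dualm D (f ⊠ g))) (tensr_comp _ (dual_tens D A B)).
rewrite (compAl _ (ev_dualm _)) -tens_swap.
rewrite (compAlm _ (ev_dual_tens _ _)) (compAlm _ (ev_dual_tens _ _)).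
rewrite /dual_pairing -!(compA (lunit 1)) -!(compA (ev D _ ⊠ _)) -!tensm1.
rewrite !interchange_nat; congr (_ ∘ _).
by rewrite !(compA (ev D _ ⊠ _)) -[in LHS]tensmM -[in RHS]tensmM !ev_dualm.
Qed.

(* The hexagon moves [DB] past [DA ⊗ A], which [ev D A] then turns into the
   unit. *)
Lemma dual_pairing_braid A B :
  dual_pairing A B ∘ (braid (dual D B) (dual D A) ⊠ idm (A ⊗ B))
    = ev D B ∘ (evr (dual D B) A ⊠ idm B)
        ∘ assocV (dual D B ⊗ dual D A) A B.
Proof.
apply: (iso_epi (iso_assoc (dual D B ⊗ dual D A) A B)).
rewrite -!compA assocK compm1 /dual_pairing /interchange !tensl_comp -!compA.
rewrite -tensm1 -(assoc_nat (braid _ _)).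
rewrite (compAl _ (pentagon _ _ _ _)).
have e : (idm (dual D A) ⊠ assocV (dual D B) A B)
    ∘ (idm (dual D A) ⊠ assoc (dual D B) A B) = idm _.
  by rewrite -tensl_comp assocK tensm1.
rewrite (compAl1 _ e) -(compA (assoc _ (_ ⊗ A) B)) -(compAl _ (assoc_nat _ _ _)).
rewrite -!tensr_comp -!hexagon !tensr_comp.
have {}e T (k : hom T _) : (idm (dual D A) ⊠ assoc A (dual D B) B)
    ∘ assoc (dual D A) (A ⊗ dual D B) B ∘ (assoc (dual D A) A (dual D B) ⊠ idm B)
    ∘ k = assoc _ _ _ ∘ assoc _ _ _ ∘ k.
  by rewrite (compAl _ (pentagon _ _ _ _)) -compA.
rewrite e (compAl1 _ (assocK _ _ _)) -(tens_split' (ev D A)) -compA.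
rewrite (compAl _ (lunit_nat _)) -tensm1 -(compAl _ (assoc_nat _ _ _)).
rewrite (compAlm _ (lunit_tens _ _)) -!tensr_comp; congr (_ ∘ (_ ⊠ _)).
by rewrite -(compAl _ (braid_nat _ _)) (compAlm _ (lunit_braid _)).
Qed.

(** Yoneda: the preimage of [idm B] is a right inverse, and injectivity at [T = A] makes it a left
    inverse. *)
Lemma iso_of_bij A B (d : hom A B) :
  (forall T, bijective (fun v : hom T A => d ∘ v)) -> is_iso d.
Proof.
move=> bd; have [s _ ds] := bd B; exists (s (idm B)); split; last exact: ds.
by apply: (bij_inj (bd A)); rewrite compA ds comp1m compm1.
Qed.

Lemma iso_precomp_bij A B C (u : hom A B) :
  is_iso u -> bijective (fun f : hom B C => f ∘ u).
Proof.
move=> [v [vu uv]]; exists (fun f => f ∘ v) => f; rewrite -compA.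
  by rewrite uv compm1.
by rewrite vu compm1.
Qed.

Lemma ev_bij A B : bijective (fun u : hom A (dual D B) => ev D B ∘ (u ⊠ idm B)).
Proof.
by exists (@transpose K D A B) => u; [exact: ev_transpose | exact: transposeK].
Qed.

Lemma iso_dual_tens A B : is_iso (dual_tens D A B).
Proof.
set b := braid (dual D B) (dual D A).
(* The pairing becomes an iterated evaluation only after precomposition with the braiding, which is
   invertible. *)
suff [d [d1 d2]] : is_iso (dual_tens D A B ∘ b).
  exists (b ∘ d); split; last by rewrite compA.
  apply: (iso_epi (iso_braid (dual D B) (dual D A))).
  by rewrite -/b -(compA b) -(compA b) -(compA d) d1 compm1 comp1m.
apply: iso_of_bij => T.
(* [F] applies the adjunction for [A], then the one for [B], and reassociates: three bijections. By
   [dual_pairing_braid], transposing [F v] is postcomposition of [v] with [dual_tens D A B ∘ b]. *)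
pose F (v : hom T (dual D B ⊗ dual D A)) :=
  ev D B ∘ ((evr (dual D B) A ∘ (v ⊠ idm A)) ⊠ idm B) ∘ assocV T A B.
have bF : bijective F.
  have := bij_comp (iso_precomp_bij 1 (iso_assocV T A B))
    (bij_comp (ev_bij (T ⊗ A) B) (evr_bij T A (dual D B))).
  by move/eq_bij; apply=> v; rewrite /F compA.
have tF v : transpose D (F v) = (dual_tens D A B ∘ b) ∘ v.
  rewrite -[RHS]ev_transpose; congr transpose.
  rewrite -compA (tensr_comp _ (dual_tens D A B)) (compAlm _ (ev_dual_tens _ _)).
  rewrite tensr_comp (compAlm _ (dual_pairing_braid _ _)) /F.
  rewrite -(compA (ev D B)) -!(compA (evr _ _ ⊠ idm B)) -tensm1 assocV_nat.
  by rewrite (tensr_comp B (evr _ _)) -!(compA (evr _ _ ⊠ idm B)).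
refine (eq_bij (bij_comp _ bF) tF).
exists (fun u => ev D (A ⊗ B) ∘ (u ⊠ idm (A ⊗ B))) => u.
  exact: transposeK.
exact: ev_transpose.
Qed.

Fixpoint iso_dual_tpow X n : is_iso (dual_tpow D X n) :=
  if n is n'.+1 then
    iso_comp (iso_dual_tens X (tpow X n'))
      (iso_tens (iso_id _) (iso_dual_tpow X n'))
  else iso_id (dual D X).

(** The single isomorphism [dual_tens D A A] carries both sides of the equation for [dualm D f] to
    the duals of the two sides for [f]; injectivity of [dualm] gives the forward direction. *)
Lemma in_E_dualm A (f : hom A A) : in_E (dualm D f) <-> in_E f.
Proof.
split=> /eqP e; apply/eqP.
  apply: dualm_inj; apply: (iso_epi (iso_dual_tens A A)).
  by rewrite !dual_tens_nat !dualm1 e.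
apply: (iso_inj (iso_dual_tens A A)).
by rewrite -dualm1 -!dual_tens_nat e.
Qed.

Lemma iso_dualm A B (f : hom A B) : is_iso (dualm D f) <-> is_iso f.
Proof.
split=> [[g [g1 g2]]|[g [g1 g2]]]; last first.
  by exists (dualm D g); split; rewrite -dualmM ?g1 ?g2 dualm1.
rewrite -[g]undualK in g1 g2; exists (undual g); split; apply: dualm_inj;
  by rewrite dualmM ?g1 ?g2 dualm1.
Qed.

End Dual.

(** * Conjugacy of endomorphisms of different objects *)

Section Conjugate.
Variable K : tt_category.
Implicit Types A B C : K.

(** Leaving the isomorphism unnamed makes it unnecessary to track coherence maps, as [cls] only sees
    endomorphisms up to conjugacy. *)
Definition conjugate A B (f : hom A A) (g : hom B B) : Prop :=
  exists u : hom A B, is_iso u /\ u ∘ f = g ∘ u.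

Lemma iso_conjugate A B (u : hom A B) (f : hom A A) (g : hom B B) :
  is_iso u -> u ∘ f = g ∘ u -> conjugate f g.
Proof. by exists u. Qed.

Lemma conjugate_sym A B (f : hom A A) (g : hom B B) :
  conjugate f g -> conjugate g f.
Proof.
move=> [u [iu e]]; have [v [vu uv]] := iu.
exists v; split; first by exists u.
by apply: (iso_inj iu); rewrite !compA uv comp1m e -compA uv compm1.
Qed.

Lemma conjugate_trans A B C (g : hom B B) (f : hom A A) (h : hom C C) :
  conjugate f g -> conjugate g h -> conjugate f h.
Proof.
move=> [u [iu eu]] [v [iv ev]]; exists (v ∘ u); split; first exact: iso_comp.
by rewrite -compA eu compA ev compA.
Qed.

Lemma conjugate_tens A B A' B' (f : hom A A) (g : hom B B) (f' : hom A' A')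
    (g' : hom B' B') :
  conjugate f f' -> conjugate g g' -> conjugate (f ⊠ g) (f' ⊠ g').
Proof.
move=> [u [iu eu]] [v [iv ev]]; exists (u ⊠ v); split; first exact: iso_tens.
by rewrite -!tensmM eu ev.
Qed.

Lemma conjugate_idm A B (u : hom A B) : is_iso u -> conjugate (idm A) (idm B).
Proof. by move=> iu; exists u; rewrite comp1m compm1. Qed.

Lemma conjugate_E A B (f : hom A A) (g : hom B B) :
  conjugate f g -> in_E f -> in_E g.
Proof. by move=> [u [iu e]]; exact: E_conj e. Qed.

Lemma conjugate_flat W m n (F : hom (tpow W m ⊗ tpow W n) _) :
  conjugate F (flat F).
Proof. exact: iso_conjugate (iso_tpowD W m n) (flatE F). Qed.

Lemma conjugate_cls W m n (f : E (tpow W m)) (g : E (tpow W n)) :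
  conjugate (val f) (val g) -> cls f = cls g.
Proof. by move=> [u [iu e]]; exact: cls_conj iu e. Qed.

Variable D : duals K.

Lemma conjugate_dualm A B (f : hom A A) (g : hom B B) :
  conjugate (dualm D f) (dualm D g) <-> conjugate f g.
Proof.
split=> [[u [iu e]]|[u [iu e]]]; apply: conjugate_sym.
  rewrite -(undualK u) in iu e; move: (undual u) iu e => {u} u iu e; exists u.
  split; first by apply/(iso_dualm D).
  by apply: (@dualm_inj _ D); rewrite !dualmM.
exists (dualm D u); split; first by apply/iso_dualm.
by rewrite -!dualmM e.
Qed.

Lemma conjugate_dual_tens A B (f : hom A A) (g : hom B B) :
  conjugate (dualm D f ⊠ dualm D g) (dualm D (f ⊠ g)).
Proof. by apply: iso_conjugate (iso_dual_tens D A B) _; rewrite dual_tens_nat. Qed.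

End Conjugate.

(** * The ring isomorphism induced by [D] *)

Section DualRing.
Variables (K : tt_category) (D : duals K) (X : K).

Let Y := dual D X.

Lemma conjugate_idm_dual_tpow m :
  conjugate (idm (tpow Y m)) (dualm D (idm (tpow X m))).
Proof. by rewrite dualm1; exact: conjugate_idm (iso_dual_tpow D X m). Qed.

(** Allowing any [g] conjugate to [dualm D f] lets the lemma serve twice: for well-definedness with
    [g = dual_endo f], and for injectivity with an arbitrary [g] in a chain of stabilizations. *)
Lemma conjugate_dual_tensl k m n (f : hom (tpow X m) (tpow X m))
    (g : hom (tpow Y n) (tpow Y n)) :
  conjugate g (dualm D f) ->
  conjugate (flat (idm (tpow Y k) ⊠ g)) (dualm D (flat (idm (tpow X k) ⊠ f))).
Proof.
move=> gf; apply: conjugate_trans (conjugate_sym (conjugate_flat _)) _.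
apply: conjugate_trans (conjugate_tens (conjugate_idm_dual_tpow k) gf) _.
apply: conjugate_trans (conjugate_dual_tens _ _ _) _.
by apply/conjugate_dualm; exact: conjugate_flat.
Qed.

Lemma conjugate_dual_tensr k m n (f : hom (tpow X m) (tpow X m))
    (g : hom (tpow Y n) (tpow Y n)) :
  conjugate g (dualm D f) ->
  conjugate (flat (g ⊠ idm (tpow Y k))) (dualm D (flat (f ⊠ idm (tpow X k)))).
Proof.
move=> gf; apply: conjugate_trans (conjugate_sym (conjugate_flat _)) _.
apply: conjugate_trans (conjugate_tens gf (conjugate_idm_dual_tpow k)) _.
apply: conjugate_trans (conjugate_dual_tens _ _ _) _.
by apply/conjugate_dualm; exact: conjugate_flat.
Qed.

Definition dual_tpowV n : hom (dual D (tpow X n)) (tpow Y n) :=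
  sval (cid (iso_dual_tpow D X n)).

Lemma dual_tpowK n : inverse_of (dual_tpow D X n) (dual_tpowV n).
Proof. exact: svalP (cid (iso_dual_tpow D X n)). Qed.

Definition dual_endo n (f : hom (tpow X n) (tpow X n)) :
    hom (tpow Y n) (tpow Y n) :=
  dual_tpowV n ∘ dualm D f ∘ dual_tpow D X n.

Lemma dual_endoE n (f : hom (tpow X n) (tpow X n)) :
  dual_tpow D X n ∘ dual_endo f = dualm D f ∘ dual_tpow D X n.
Proof. by rewrite /dual_endo (compAl1 _ (dual_tpowK n).2). Qed.

Lemma conjugate_dual_endo n (f : hom (tpow X n) (tpow X n)) :
  conjugate (dual_endo f) (dualm D f).
Proof. exact: iso_conjugate (iso_dual_tpow D X n) (dual_endoE f). Qed.

Lemma in_E_dual_endo n (f : hom (tpow X n) (tpow X n)) :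
  in_E f -> in_E (dual_endo f).
Proof.
move=> Ef; apply: conjugate_E (conjugate_sym (conjugate_dual_endo f)) _.
by apply/in_E_dualm.
Qed.

Definition dualE n (f : E (tpow X n)) : E (tpow Y n) :=
  mkE (in_E_dual_endo (valP f)).

Lemma dualE_cls m n (f : E (tpow X m)) (g : E (tpow X n)) :
  cls f = cls g -> cls (dualE f) = cls (dualE g).
Proof.
pose h (p : endo_pair X) := cls (dualE (projT2 p)).
suff hh p q : clos_refl_sym_trans _ (@stab_step _ X) p q -> h p = h q.
  by move=> /eqmodP/asboolP/hh.
elim=> {p q} [_ _ [k i a|k i a]|//|p q _ //|p q r _ -> _ -> //]; rewrite /h /=.
  rewrite -(cls_left k); apply: conjugate_cls => /=.
  apply: conjugate_trans (conjugate_dual_tensl _ (conjugate_dual_endo _)) _.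
  exact: conjugate_sym (conjugate_dual_endo _).
rewrite -(cls_right k); apply: conjugate_cls => /=.
apply: conjugate_trans (conjugate_dual_tensr _ (conjugate_dual_endo _)) _.
exact: conjugate_sym (conjugate_dual_endo _).
Qed.

Lemma dualE_surj n (g : E (tpow Y n)) :
  exists f : E (tpow X n), dualE f = g.
Proof.
have [k1 k2] := dual_tpowK n.
pose f := undual (dual_tpow D X n ∘ val g ∘ dual_tpowV n).
have e : dual_endo f = val g.
  by rewrite /dual_endo undualK -!compA k1 compm1 compA k1 comp1m.
have Ef : in_E f.
  apply/(in_E_dualm D); apply: conjugate_E (conjugate_dual_endo f) _.
  by rewrite e; exact: valP.
by exists (mkE Ef); apply: val_inj.
Qed.

Lemma dualE_cls_inj m n (f : E (tpow X m)) (g : E (tpow X n)) :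
  cls (dualE f) = cls (dualE g) -> cls f = cls g.
Proof.
(* The induction runs over chains on the [DX] side, whose members need not be literally of the form
   [dualE f]; hence the quantification over all [f] and [g] with duals conjugate to the ends. *)
pose h (p q : endo_pair Y) := forall m n (f : E (tpow X m)) (g : E (tpow X n)),
  conjugate (val (projT2 p)) (dualm D (val f)) ->
  conjugate (val (projT2 q)) (dualm D (val g)) -> cls f = cls g.
suff hh p q : clos_refl_sym_trans _ (@stab_step _ Y) p q -> h p q.
  move=> /eqmodP/asboolP/hh; apply; exact: conjugate_dual_endo.
have same r : h r r.
  move=> i j a b pa pb; apply: conjugate_cls.
  by apply/(conjugate_dualm D); exact: conjugate_trans (conjugate_sym pa) pb.
elim=> {p q} [_ _ [k i c|k i c]|p|p q _ pq|p q r _ pq _ qr] m' n' a b /= pa qb.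
- transitivity (cls (flat_endo (E_tensl (tpow X k) a))); first by rewrite cls_left.
  apply: conjugate_cls; apply/(conjugate_dualm D).
  exact: conjugate_trans (conjugate_sym (conjugate_dual_tensl k pa)) qb.
- transitivity (cls (flat_endo (E_tensr (tpow X k) a))); first by rewrite cls_right.
  apply: conjugate_cls; apply/(conjugate_dualm D).
  exact: conjugate_trans (conjugate_sym (conjugate_dual_tensr k pa)) qb.
- exact: (same _ _ _ _ _ pa qb).
- by rewrite (pq _ _ _ _ qb pa).
(* Transitivity needs a preimage of the middle term, which surjectivity supplies. *)
have [c cE] := dualE_surj (projT2 q).
have qc : conjugate (val (projT2 q)) (dualm D (val c)).
  by rewrite -cE; exact: conjugate_dual_endo.
by rewrite (pq _ _ _ _ pa qc); exact: (qr _ _ _ _ qc qb).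
Qed.

Definition dual_ring (x : endo_ring X) : endo_ring Y :=
  cls (dualE (projT2 (repr x))).

Lemma dual_ringE n (f : E (tpow X n)) : dual_ring (cls f) = cls (dualE f).
Proof. by apply: dualE_cls; rewrite -[RHS]reprK /cls; case: (repr _). Qed.

Lemma dual_ring_bij : bijective dual_ring.
Proof.
have s y : exists x, dual_ring x = y.
  elim/endo_ring_ind: y => n g; have [f <-] := dualE_surj g.
  by exists (cls f); rewrite dual_ringE.
exists (fun y => sval (cid (s y))) => [x|y]; last exact: svalP (cid (s y)).
move: (svalP (cid (s (dual_ring x)))).
elim/endo_ring_ind: (sval _) => m f; elim/endo_ring_ind: x => n g.
by rewrite !dual_ringE; exact: dualE_cls_inj.
Qed.

(** Two classes have representatives on a common tensor power, where the ring operations are those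
    of endomorphisms; the same reduction serves for products. *)
Lemma dual_ringD : {morph dual_ring : x y / x + y}.
Proof.
apply: endo_ring_ind2 => n f g.
have aE W := @endo_add_same K W n : forall f g, cls f + cls g = _.
rewrite aE !dual_ringE aE; congr cls; apply: val_inj => /=.
by rewrite /dual_endo dualmD compDl compDr.
Qed.

Lemma dual_ringM : {morph dual_ring : x y / x * y}.
Proof.
apply: endo_ring_ind2 => n f g; rewrite [in RHS]mulrC.
have mE W := @endo_mul_same K W n : forall f g, cls f * cls g = _.
rewrite mE !dual_ringE mE; congr cls; apply: val_inj => /=.
rewrite /dual_endo dualmM -!compA; congr (_ ∘ _ ∘ _).
by rewrite (compAl1 _ (dual_tpowK n).2).
Qed.

Lemma dual_ring0 : dual_ring 0 = 0.
Proof. by apply: (addrI (dual_ring 0)); rewrite -dual_ringD !addr0. Qed.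

Lemma dual_ring1 : dual_ring 1 = 1.
Proof.
rewrite (dual_ringE (mkE (E1 (tpow X 0)))); congr cls; apply: val_inj => /=.
by rewrite /dual_endo dualm1 comp1m (dual_tpowK 0).1.
Qed.

HB.instance Definition _ := GRing.isNmodMorphism.Build _ _ dual_ring
  (dual_ring0, dual_ringD).
HB.instance Definition _ := GRing.isMonoidMorphism.Build _ _ dual_ring
  (dual_ring1, dual_ringM).

End DualRing.

(** * Exact triangles, split monomorphisms and cones *)

Section Triangles.
Variable K : triangulated_category.
Implicit Types A B C T : K.

(** Map the trivial triangle on [idm A] to the given one: [g ∘ f] then factors through a zero
    object. *)
Lemma exact_comp0 A B C (f : hom A B) (g : hom B C) (h : hom C (susp A)) :
  exact_tri f g h -> g ∘ f = 0.
Proof.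
have [Z Z0] := zero_exists K => fgh.
have [//|c [<- _]] := exact_fill (exact_id A Z0) fgh (a := idm A) (b := f).
exact: compr0.
Qed.

(** Filling in a map from the rotated trivial triangle on [T] gives a map between suspensions, and
    fullness of [susp] desuspends it to [k]. *)
Lemma exact_factor A B C T (f : hom A B) (g : hom B C) (h : hom C (susp A))
    (v : hom T B) :
  exact_tri f g h -> g ∘ v = 0 -> exists k, v = f ∘ k.
Proof.
have [Z Z0] := zero_exists K => fgh gv.
have t1 := (exact_rot _ _ _).1 (exact_id T Z0).
have t2 := (exact_rot _ _ _).1 fgh.
have [|c [_ e]] := exact_fill t1 t2 (a := v) (b := 0); first by rewrite gv comp0r.
have [s _ cs] := suspm_bij T A; exists (s c).
apply: (bij_inj (suspm_bij T B)); rewrite suspmM cs; apply: oppr_inj.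
by rewrite -compNr -e suspm1 comprN compm1.
Qed.

(** The cone of a split monomorphism is a complement. Duality produces retracts, while thick ideals
    are closed under biproduct summands. *)
Lemma retract_biproduct A S (i : hom A S) (r : hom S A) :
  r ∘ i = idm A -> exists C, is_biproduct S A C.
Proof.
move=> ri; have [C [g [h ex]]] := exact_cone i; exists C.
have ex' := (exact_rot _ _ _).1 ex.
(* [suspm i ∘ h] vanishes, and [suspm r] is a left inverse of [suspm i]. *)
have h0 : h = 0.
  have := exact_comp0 ((exact_rot _ _ _).1 ex'); rewrite compNr => e.
  rewrite -[h]comp1m -suspm1 -ri suspmM -compA -[suspm i ∘ h]opprK e oppr0.
  exact: compr0.
have [|j gj] := exact_factor (v := idm C) ex'; first by rewrite compm1.
have gi := exact_comp0 ex.
(* The section [j] of [g] is corrected so that [r] kills it. *)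
exists i, (j - i ∘ r ∘ j), r, g; split => //.
- by rewrite compDr comprN (compAlm _ gi) comp0r subr0.
- by rewrite compDr comprN (compAlm _ ri) comp1m subrr.
set s := j - i ∘ r ∘ j.
have gs : g ∘ s = idm C by rewrite compDr comprN (compAlm _ gi) comp0r subr0.
(* The defect is killed by [g], hence equals [i ∘ k]; it is also killed by [r], which forces
   [k = 0]. *)
have [|k ek] := exact_factor (v := idm S - (i ∘ r + s ∘ g)) ex.
  rewrite compDr comprN compDr compm1 (compAlm _ gi) comp0r (compAlm _ gs) comp1m.
  by rewrite add0r subrr.
have : r ∘ (idm S - (i ∘ r + s ∘ g)) = 0.
  rewrite compDr comprN compDr compm1 (compAlm _ ri) comp1m.
  have rs : r ∘ s = 0 by rewrite compDr comprN (compAlm _ ri) comp1m subrr.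
  by rewrite (compAlm _ rs) comp0r addr0 subrr.
rewrite ek (compAlm _ ri) comp1m => k0.
by apply/esym/eqP; rewrite -subr_eq0 ek k0 compr0.
Qed.

Lemma is_cone_iso A B A' B' (f : hom A B) (f' : hom A' B') C (u : hom A A')
    (v : hom B B') :
  is_iso u -> is_iso v -> v ∘ f = f' ∘ u -> is_cone f C -> is_cone f' C.
Proof.
move=> iu iv e [g [h ex]]; have [w [wv vw]] := iv.
have i1 : is_iso (idm C) by exists (idm C); split; rewrite comp1m.
exists (g ∘ w), (suspm u ∘ h); apply: (exact_iso iu iv i1 e _ _ ex).
  by rewrite -compA wv comp1m compm1.
by rewrite compm1.
Qed.

End Triangles.

(** * Thick tensor ideals under cones, retracts and duals *)

Section Ideals.
Variables (K : tt_category) (P : K -> Prop).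
Hypothesis thickP : thick_tensor_ideal P.
Implicit Types A B C : K.

(* The octahedron on [idm B ∘ f] compares two cones of [f]. *)
Lemma ideal_cone A B (f : hom A B) C C' :
  is_cone f C -> is_cone f C' -> P C -> P C'.
Proof.
have [Z Z0] := zero_exists K.
move=> [g [h ex]] [g' [h' ex']] PC; rewrite -[f]comp1m in ex'.
have [a [b [t _ _ _ _]]] := exact_octa ex (exact_id B Z0) ex'.
have PZ := ideal_zero thickP Z0.
(* Two rotations put the zero object first: [Z -> susp C -> susp C']. *)
have t' := (exact_rot _ _ _).1 ((exact_rot _ _ _).1 t).
apply/(ideal_susp thickP); apply: (ideal_exact thickP t' PZ).
by apply/(ideal_susp thickP).
Qed.

Lemma ideal_retract A S (i : hom A S) (r : hom S A) :
  r ∘ i = idm A -> P S -> P A.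
Proof. by move=> /retract_biproduct[C] /(ideal_summand thickP). Qed.

Lemma ideal_tensr A B : P A -> P (A ⊗ B).
Proof.
move=> /(ideal_tens thickP B); apply: (ideal_iso thickP).
by exists (braid B A); exact: iso_braid.
Qed.

Lemma ideal_dual (D : duals K) A : P (dual D A) <-> P A.
Proof.
split=> PA.
  apply: (ideal_retract (S := (A ⊗ dual D A) ⊗ A)
    (i := (coev D A ⊠ idm A) ∘ lunitV A)
    (r := runit A ∘ (idm A ⊠ ev D A) ∘ assoc A (dual D A) A)).
    by rewrite -!compA; exact: ev_coev.
  by apply: ideal_tensr; exact: (ideal_tens thickP).
apply: (ideal_retract (S := dual D A ⊗ (A ⊗ dual D A))
  (i := (idm (dual D A) ⊠ coev D A) ∘ runitV (dual D A))
  (r := lunit (dual D A) ∘ (ev D A ⊠ idm (dual D A))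
          ∘ assocV (dual D A) A (dual D A))).
  by rewrite -!compA; exact: coev_ev.
by apply: (ideal_tens thickP); exact: ideal_tensr.
Qed.

End Ideals.

(** * Cones of dual morphisms and the comparison of the maps [rho] *)

Lemma dualm_cone (K : tt_category) (D : duals K) (A B C : K) (f : hom A B) :
  dual_exact D -> is_cone f C -> is_cone (dualm D f) (susp (dual D C)).
Proof.
(* The dual triangle starts with [dualm D g]; one rotation puts [dualm D f] first and
   [susp (dual D C)] at the cone. *)
move=> [t [_ _ tE]] [g [h /tE/exact_rot ex]].
by exists (suspm (dualm D h) ∘ t A), (- suspm (dualm D g)).
Qed.

Theorem proposition5p7 (K : tt_category) (hK : essentially_small K)
    (D : duals K) (hD : dual_exact D) (X : K) :
  exists phi : {rmorphism endo_ring X -> endo_ring (dual D X)},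
    [/\ bijective phi,
        forall (n : nat) (f : E (tpow X n)),
          exists g : E (tpow (dual D X) n),
            regarded_along (dual_tpow D X n) (dualm D (val f)) (val g)
            /\ phi (cls f) = cls g
      & forall P : spc K,
          (supp X P <-> supp (dual D X) P)
          /\ (supp X P ->
              forall r : endo_ring X, rho P r <-> rho P (phi r))].
Proof.
exists (dual_ring D (X := X) : {rmorphism _ -> _}); split.
- exact: dual_ring_bij.
- move=> n f; exists (dualE D f); split; last exact: dual_ringE.
  by split; [exact: iso_dual_tpow | exact: dual_endoE].
move=> P; have thickP := prime_thick P; split.
  by rewrite /supp (ideal_dual thickP).
move=> _ r.
have coneD n (f : E (tpow X n)) C :
    is_cone (val f) C -> is_cone (val (dualE D f)) (susp (dual D C)).
  move=> /(dualm_cone hD).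
  have [u [iu e]] := conjugate_sym (conjugate_dual_endo D (val f)).
  exact: (is_cone_iso iu iu e).
have PD C : P (susp (dual D C)) <-> P C.
  by rewrite (ideal_susp thickP) (ideal_dual thickP).
split=> [[n [f [C [-> fC PC]]]]|[n [g [C' [e gC' PC']]]]].
  exists n, (dualE D f), (susp (dual D C)); split; first exact: dual_ringE.
    exact: coneD.
  by rewrite PD.
(* Conversely, write [g] as the dual of some [f], so that [r = cls f] by injectivity. If a cone [C]
   of [f] were in [P], so would be the cone [susp (dual D C)] of [g], hence also its other cone
   [C']. *)
have [f fg] := dualE_surj g; have [C fC] := exact_cone (val f).
exists n, f, C; split => //.
  by apply: (bij_inj (dual_ring_bij D X)); rewrite dual_ringE fg.
move=> PC; apply: PC'; apply: (ideal_cone thickP (coneD _ _ _ fC)).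
  by rewrite fg.
by rewrite PD.
Qed.
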